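(* Suppose $h:\mathbb{R}^d\to\mathbb{R}$ satisfies the exponential decay condition up to order $0$, i.e. $h$ is continuous and $\|h\|_{0,\beta,p,q}:=\sup_{\bm x\in\mathbb{R}^d}|\exp(\beta\|\bm x\|_p^q)h(\bm x)|<\infty$ for some $\beta>0$, $1\le p\le\infty$ and $1\le q<\infty$. For $a>0$ let $\widetilde h(\bm x)=\sum_{\bm k\in\mathbb{Z}^d}h(\bm x+2a\bm k)$ for $\bm x\in[-a,a]^d$. Write $$C_{d,q}:=\sum_{w=1}^\infty\left((2w+1)^d-(2w-1)^d\right)e^{-((2w-1)^q-1)}<\infty.$$ Then for any $a\ge\beta^{-1/q}$ and $\bm x\in[-a,a]^d$, $$|h(\bm x)-\widetilde h(\bm x)|\le C_{d,q}\|h\|_{0,\beta,p,q}\,e^{-\beta a^q}.$$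
   Context: $\|\bm x\|_p$ is the $\ell_p$-norm on $\mathbb{R}^d$. *)

(* Defs.v *)
From HB Require Import structures.
From mathcomp Require Import all_boot all_order all_algebra.
From mathcomp Require Import all_classical all_reals all_analysis.
Import Order.TTheory GRing.Theory Num.Theory.
Import numFieldNormedType.Exports.

Set Implicit Arguments.
Unset Strict Implicit.
Unset Printing Implicit Defensive.

Local Open Scope classical_set_scope.
Local Open Scope ring_scope.

(* Only [1 <= p] is meaningful; the value at [-oo] is a dummy. The norm
   [`|x|] on row vectors is the maximum of the absolute values of the entries. *)
Definition lpnorm (R : realType) (d : nat) (p : \bar R) (x : 'rV[R]_d) : R :=
  match p with
  | r%:E => (\sum_(i < d) `|x ord0 i| `^ r) `^ r^-1
  | +oo%E => `|x|
  | -oo%E => 0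
  end.

Definition expnorm0 (R : realType) (d : nat) (beta : R) (p : \bar R) (q : R)
    (h : 'rV[R]_d -> R) : \bar R :=
  ereal_sup (range (fun x => `|expR (beta * lpnorm p x `^ q) * h x|%:E)).

Definition exp_decay0 (R : realType) (d : nat) (beta : R) (p : \bar R) (q : R)
    (h : 'rV[R]_d -> R) : Prop :=
  continuous h /\ (expnorm0 beta p q h < +oo)%E.

Definition cube (R : realType) (d : nat) (a : R) : set 'rV[R]_d :=
  [set x | forall i, - a <= x ord0 i <= a].

Definition shifted (R : realType) (d : nat) (a : R) (h : 'rV[R]_d -> R)
    (x : 'rV[R]_d) (k : 'rV[int]_d) : \bar R :=
  (h (x + (2 * a) *: map_mx intr k))%:E.

(* [esum] is only meant for nonnegative terms, so the (absolutely convergent)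
   sum is taken as the difference of the sums of positive and negative parts. *)
Definition periodization (R : realType) (d : nat) (a : R)
    (h : 'rV[R]_d -> R) (x : 'rV[R]_d) : R :=
  fine (\esum_(k in [set: 'rV[int]_d]) (shifted a h x)^\+ k
        - \esum_(k in [set: 'rV[int]_d]) (shifted a h x)^\- k)%E.

Definition Cdq (R : realType) (d : nat) (q : R) : \bar R :=
  (\sum_(1 <= w <oo)
     (((2 * w%:R + 1) ^+ d - (2 * w%:R - 1) ^+ d)
        * expR (- ((2 * w%:R - 1) `^ q - 1)))%:E)%E.

(* Main.v *)
Require Import Defs.
From HB Require Import structures.
From mathcomp Require Import all_boot all_order all_algebra.
From mathcomp Require Import all_classical all_reals all_analysis.
From mathcomp Require Import finmap zify ring lra.
Import Order.TTheory GRing.Theory Num.Theory.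
Import numFieldNormedType.Exports.

Local Open Scope classical_set_scope.
Local Open Scope ring_scope.

(** Write [|k|] for the maximum norm of an integer vector [k] ([supn k] below).
    The term [k = 0] of the periodization is [h x] itself, so the error is at
    most the sum of [|h (x + 2 a k)|] over [k != 0]. For [x] in the cube, some
    coordinate of [x + 2 a k] has absolute value at least [2 a |k| - a], and
    every l_p norm dominates every coordinate. Hence, with [M] the weighted sup
    norm of [h],
      [|h (x + 2 a k)| <= M exp (- beta a^q (2 |k| - 1)^q)]
    ([shifted_shell_bound]). This bound depends on [k] only through [w = |k|],
    and the shell [|k| = w] is the difference of two discrete cubes, so that it
    has [(2 w + 1)^d - (2 w - 1)^d] points. Summing shell by shell
    ([esum_shells]) turns the lattice sum into a series over [w >= 1].

    If [T = beta a^q >= 1], which is what [a >= beta^(-1/q)] means, then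
    [T u >= T + (u - 1)] for [u = (2 w - 1)^q >= 1]. Thus each term splits off
    the factor [exp (- T)] and what remains is the term of [C_{d,q}].

    Finiteness of [C_{d,q}] and absolute convergence for arbitrary [a > 0] both
    come from [shell_series_lty]: since [(2 w - 1)^q >= w], the terms are a
    polynomial in [w] times a decaying exponential of [w]. *)

(** * Shells of the integer lattice *)

Definition supn {d : nat} (k : 'rV[int]_d) : nat := \max_(i < d) `|k ord0 i|%N.

Lemma leq_supn {d n : nat} {k : 'rV[int]_d} :
  reflect (forall i, (`|k ord0 i| <= n)%N) (supn k <= n)%N.
Proof.
by apply: (iffP (bigmax_leqP _ _ _)) => H i; [exact: H | move=> _; exact: H].
Qed.

Lemma supn_attained {d : nat} (k : 'rV[int]_d) :
  k != 0 -> exists i, `|k ord0 i|%N = supn k.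
Proof.
case: d k => [k|d k _]; first by rewrite (thinmx0 k) eqxx.
have [|i ki] := bigop.eq_bigmax (fun i : 'I_d.+1 => `|k ord0 i|%N).
  by rewrite card_ord.
by exists i; rewrite /supn ki.
Qed.

Lemma supn_eq0 {d : nat} (k : 'rV[int]_d) : (supn k == 0)%N = (k == 0).
Proof.
rewrite -leqn0; apply/leq_supn/eqP => [k0|-> i]; last by rewrite mxE.
by apply/rowP => i; rewrite mxE; apply/eqP; rewrite -absz_eq0 -leqn0 k0.
Qed.

(** The ball of radius [n] for [supn] ([in_box]), given as an injective image of
    a function space so that its cardinal can be read off. *)
Definition box (d n : nat) : {fset 'rV[int]_d} :=
  [fset \row_i ((f i)%:Z - n%:Z) | f : {ffun 'I_d -> 'I_(2 * n).+1} in predT]%fset.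

Lemma in_box (d n : nat) (k : 'rV[int]_d) : (k \in box d n) = (supn k <= n)%N.
Proof.
apply/imfsetP/leq_supn => [[f _ ->] i|kn].
  by rewrite mxE; case: (f i) => j /= jn; lia.
exists [ffun i => inord `|(k ord0 i + n%:Z)%R|%N] => //.
apply/rowP => i; rewrite !mxE ffunE inordK.
  have := kn i; rewrite (_ : k 0%R i = k ord0 i)//; lia.
by have := kn i; lia.
Qed.

Lemma card_box (d n : nat) : #|` box d n| = ((2 * n).+1 ^ d)%N.
Proof.
rewrite card_imfset /=; last first.
  move=> f g /rowP fg; apply/ffunP => i; apply/val_inj.
  by have := fg i; rewrite !mxE => /addIr [].
by rewrite -cardE card_ffun !card_ord.
Qed.

Lemma shell_card_ge0 (R : realType) (d w : nat) : (0 < w)%N ->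
  (0 <= (2 * w%:R + 1) ^+ d - (2 * w%:R - 1) ^+ d :> R)%R.
Proof.
move=> w0; have w1 : (1 <= w%:R :> R)%R by rewrite ler1n.
by rewrite subr_ge0 lerXn2r// ?nnegrE; lra.
Qed.

Local Open Scope ereal_scope.

(** The shell [|k| = w] is [box d w] minus [box d (w - 1)]. The factor in front
    of [g w] is its cardinal, and these shells partition the nonzero vectors. *)
Lemma esum_shells (R : realType) (d : nat) (g : nat -> R) :
  (forall w, 0 <= g w)%R ->
  \esum_(k in ~` [set 0%R : 'rV[int]_d]) (g (supn k))%:E =
  \sum_(1 <= w <oo)
    (((2 * w%:R + 1) ^+ d - (2 * w%:R - 1) ^+ d) * g w)%:E.
Proof.
move=> g0.
have -> : ~` [set 0%R : 'rV[int]_d] =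
    \bigcup_(w in [set w | (1 <= w)%N]) [set` (box d w `\` box d w.-1)%fset].
  apply/seteqP; split => [k /eqP k0|k [w /= w1]].
    have sk : (0 < supn k)%N by rewrite lt0n supn_eq0.
    by exists (supn k) => //=; rewrite !inE !in_box; lia.
  rewrite !inE !in_box => /andP[kw _] /= k0; move: kw; rewrite k0.
  by have /eqP -> : supn (0%R : 'rV[int]_d) == 0%N by rewrite supn_eq0.
rewrite esum_bigcupT; last first.
- by move=> k; rewrite lee_fin.
- by move=> i j _ _ [k []]; rewrite /= !inE !in_box; lia.
rewrite eseries_cond nneseries_esum; last first.
  by move=> w /= w1; rewrite lee_fin mulr_ge0// shell_card_ge0.
apply: eq_esum => w /= w1.
rewrite (@eq_esum _ _ _ _ (fun=> (g w)%:E)); last first.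
  move=> k /=; rewrite !inE !in_box => kw; congr (g _)%:E.
  lia.
rewrite esum_fset//; last by move=> k _; rewrite lee_fin.
rewrite fsbig_finite//= set_fsetK sumEFin big_const_seq count_predT iter_addr_0.
rewrite cardfsDS; last first.
  by apply/fsubsetP => k; rewrite !in_box; lia.
rewrite !card_box -(mulr_natl (g w)) natrB; last first.
  by case: (d) => // e; rewrite leq_exp2r//; lia.
congr ((_ * _)%:E); rewrite !natrX; congr (_ ^+ _ - _ ^+ _)%R.
  by rewrite -natr1 natrM.
by rewrite -natr1 natrM -subn1 natrB//; ring.
Qed.

Local Close Scope ereal_scope.

(** * Convergence of the shell series *)

(** One term [(c y)^d / d!] of the exponential series already gives this. *)
Lemma exprn_le_expR (R : realType) (d : nat) (c : R) : 0 < c ->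
  exists2 K : R, 0 <= K & forall y, 0 <= y -> y ^+ d <= K * expR (c * y).
Proof.
move=> c0; exists (d`!%:R / c ^+ d) => [|y y0].
  by rewrite divr_ge0 ?exprn_ge0// ltW.
case: d => [|d].
  by rewrite !expr0 divr1 mul1r -[leLHS]expR0 ler_expR mulr_ge0// ltW.
have := @expR_ge1Dxn R (c * y) d (mulr_ge0 (ltW c0) y0).
rewrite exprMn => h; rewrite mulrAC ler_pdivlMr ?exprn_gt0//.
rewrite mulrC [leRHS]mulrC -ler_pdivrMr; first by lra.
by rewrite ltr0n fact_gt0.
Qed.

Local Open Scope ereal_scope.

(** Half of the exponential rate absorbs the factor [(2 w + 1)^d <= (3 w)^d];
    the other half leaves a geometric series. *)
Lemma shell_series_lty (R : realType) (d : nat) (g : nat -> R) (K c : R) :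
  (0 < c)%R ->
  (forall w, (0 < w)%N -> 0 <= g w <= K * expR (- (c * w%:R)))%R ->
  \sum_(1 <= w <oo)
    (((2 * w%:R + 1) ^+ d - (2 * w%:R - 1) ^+ d) * g w)%:E < +oo.
Proof.
move=> c0 gK.
have K0 : (0 <= K)%R.
  have /andP[g0 g1] := gK 1%N isT.
  by have := le_trans g0 g1; rewrite pmulr_lge0// expR_gt0.
have c2 : (0 < c / 2)%R by rewrite divr_gt0.
have [L L0 HL] := @exprn_le_expR R d _ c2.
pose z := expR (- (c / 2)).
have z1 : (z < 1)%R by rewrite expR_lt1; lra.
pose A := (3 ^+ d * L * K)%R.
have A0 : (0 <= A)%R by rewrite !mulr_ge0// exprn_ge0.
have term_ge0 w : (1 <= w)%N ->
    (0 <= ((2 * w%:R + 1) ^+ d - (2 * w%:R - 1) ^+ d) * g w)%R.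
  by move=> w1; have /andP[g0 _] := gK w w1; rewrite mulr_ge0// shell_card_ge0.
have term_le w : (1 <= w)%N ->
    (((2 * w%:R + 1) ^+ d - (2 * w%:R - 1) ^+ d) * g w <= geometric A z w)%R.
  move=> w1; have w1' : (1 <= w%:R :> R)%R by rewrite ler1n.
  have /andP[g0 gle] := gK w w1.
  have -> : (geometric A z w = 3 ^+ d * (L * expR (c / 2 * w%:R)) *
                       (K * expR (- (c * w%:R))))%R.
    rewrite /geometric/= /A /z -expRM_natr.
    rewrite (_ : - (c / 2) * w%:R = c / 2 * w%:R + - (c * w%:R))%R ?expRD; last by lra.
    by ring.
  apply: ler_pM => //; first exact: shell_card_ge0.
  apply: (@le_trans _ _ ((3 * w%:R) ^+ d)%R); last first.
    by rewrite exprMn ler_wpM2l ?exprn_ge0// HL.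
  rewrite lerBlDr (le_trans (_ : _ <= (3 * w%:R) ^+ d)%R)//.
    by rewrite lerXn2r// ?nnegrE; lra.
  by rewrite lerDl exprn_ge0//; lra.
apply: (@le_lt_trans _ _ (A / (1 - z))%:E); last by rewrite ltry.
apply: lime_le.
  by apply: is_cvg_nneseries => w w1 _; rewrite lee_fin term_ge0.
apply: nearW => n; rewrite sumEFin lee_fin.
apply: (@le_trans _ _ (series (geometric A z) n)).
  rewrite /series/=; case: n => [|n]; first by rewrite !big_geq.
  rewrite big_add1/= [leRHS]big_nat_recl// -[leLHS]add0r lerD//=.
    by rewrite mulr_ge0.
  by apply: ler_sum => w _; exact: term_le.
rewrite geometric_seriesE ?lt_eqF//= ler_pM2r ?invr_gt0 ?subr_gt0//.
by rewrite ler_piMr// gerBl exprn_ge0// expR_ge0.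
Qed.

(** * Removing one term from a signed sum *)

(** The terms at [i] cancel: they are the positive and the negative part of
    [f i]. What is left is the difference of two sums of nonnegative terms whose
    total is the right-hand side. *)
Lemma normr_esum_posneg_rem (R : realType) (T : choiceType) (i : T)
    (f : T -> R) : summable [set: T] (EFin \o f) ->
  `|(f i - fine (\esum_(k in [set: T]) (EFin \o f)^\+ k
               - \esum_(k in [set: T]) (EFin \o f)^\- k))%R|%:E
  <= \esum_(k in ~` [set i]) `|f k|%:E.
Proof.
move=> sf.
have sp := summable_funepos sf; have sn := summable_funeneg sf.
have split1 (u : T -> \bar R) : (forall k, 0 <= u k) ->
    \esum_(k in [set: T]) u k = u i + \esum_(k in ~` [set i]) u k.
  by move=> u0; rewrite (esumID [set i])// !setTI esum_set1.
rewrite split1; last by move=> k; rewrite funepos_ge0.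
rewrite split1; last by move=> k; rewrite funeneg_ge0.
have -> : \esum_(k in ~` [set i]) `|f k|%:E =
    \esum_(k in ~` [set i]) (EFin \o f)^\+ k +
    \esum_(k in ~` [set i]) (EFin \o f)^\- k.
  rewrite -esumD; [|by move=> *; rewrite funepos_ge0
                   |by move=> *; rewrite funeneg_ge0].
  apply: eq_esum => k _; rewrite -[LHS]/((abse \o (EFin \o f)) k).
  by rewrite fune_abse.
have finrem (u : T -> \bar R) : (forall k, 0 <= u k) -> summable [set: T] u ->
    exists2 r : R, (0 <= r)%R & \esum_(k in ~` [set i]) u k = r%:E.
  move=> u0 su; have e0 : 0 <= \esum_(k in ~` [set i]) u k by exact: esum_ge0.
  have finu : \esum_(k in ~` [set i]) u k \is a fin_num.
    rewrite ge0_fin_numE//; apply: le_lt_trans su.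
    rewrite (eq_esum (b := u)); last by move=> k _; rewrite gee0_abs.
    by rewrite (split1 u)// leeDr.
  by exists (fine (\esum_(k in ~` [set i]) u k)); rewrite ?fine_ge0 ?fineK.
have [A A0 ->] := finrem _ (funepos_ge0 _) sp.
have [B B0 ->] := finrem _ (funeneg_ge0 _) sn.
have fE : f i = (Num.max (f i) 0 - Num.max (- f i) 0)%R.
  have [h|h] := leP (f i) 0%R; first by rewrite max_l; lra.
  by rewrite max_r; lra.
rewrite funeposE funenegE /= -!EFin_max -!EFinD/= ?lee_fin.
rewrite [X in (`|X - _|)%R]fE ler_norml.
by apply/andP; split; lra.
Qed.

Local Close Scope ereal_scope.

(** * Decay of the translates *)

(** For finite [p], keep a single term of the sum and take the [p]-th root. *)
Lemma normr_le_lpnorm (R : realType) (d : nat) (p : \bar R) (x : 'rV[R]_d) i :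
  (1 <= p)%E -> `|x ord0 i| <= lpnorm p x.
Proof.
case: p => [r||] //= r1; last first.
  rewrite [leRHS]/Num.Def.normr/= mx_normrE; apply/bigmax_geP; right.
  by exists (ord0, i).
rewrite lee_fin in r1.
have r0 : 0 < r by lra.
rewrite -[leLHS](@powRr1 R)// -(divff (lt0r_neq0 r0)) powRrM.
apply: ge0_ler_powR; rewrite ?nnegrE ?powR_ge0 ?invr_ge0 ?(ltW r0)//.
  by apply: sumr_ge0 => j _; exact: powR_ge0.
rewrite (bigD1 i)//= lerDl.
by apply: sumr_ge0 => j _; exact: powR_ge0.
Qed.

Lemma exp_decay0_bound (R : realType) (d : nat) (h : 'rV[R]_d -> R)
    (beta : R) (p : \bar R) (q : R) : exp_decay0 beta p q h ->
  exists M : R, [/\ 0 <= M, expnorm0 beta p q h = M%:E &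
    forall y, `|h y| <= M * expR (- (beta * lpnorm p y `^ q))].
Proof.
move=> [_ hoo].
have ub y : (`|expR (beta * lpnorm p y `^ q) * h y|%:E
              <= expnorm0 beta p q h)%E.
  by apply: ereal_sup_ubound; exists y.
have ge0 : (0 <= expnorm0 beta p q h)%E by apply: le_trans (ub 0).
have fin : expnorm0 beta p q h \is a fin_num by rewrite ge0_fin_numE.
exists (fine (expnorm0 beta p q h)); split; rewrite ?fine_ge0 ?fineK// => y.
have := ub y; rewrite -{1}(fineK fin) lee_fin normrM (ger0_norm (expR_ge0 _)).
by rewrite expRN ler_pdivlMr ?expR_gt0// mulrC.
Qed.

(** A coordinate of [k] of maximal absolute value [|k|] moves the corresponding
    coordinate of [x] by [2 a |k|], while that of [x] is at most [a]. *)
Lemma lpnorm_shift_ge (R : realType) (d : nat) (p : \bar R) (a : R)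
    (x : 'rV[R]_d) (k : 'rV[int]_d) :
  (1 <= p)%E -> 0 <= a -> cube a x -> k != 0 ->
  a * (2 * (supn k)%:R - 1) <= lpnorm p (x + (2 * a) *: map_mx intr k).
Proof.
move=> p1 a0 xa k0; have [i ki] := supn_attained _ k0.
apply: le_trans (normr_le_lpnorm _ _ _ _ i p1); rewrite !mxE -ki.
have xi : `|x ord0 i| <= a by rewrite ler_norml xa.
have -> : a * (2 * `|k ord0 i|%N%:R - 1) = `|2 * a * (k ord0 i)%:~R| - a.
  rewrite normrM (@ger0_norm _ (2 * a)) ?mulr_ge0// natr_absz intr_norm; ring.
apply: (@le_trans _ _ (`|2 * a * (k ord0 i)%:~R| - `|x ord0 i|)).
  by rewrite lerB.
by rewrite addrC lerBlDr; apply: le_trans (ler_normB _ _); rewrite addrK.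
Qed.

Lemma natr_shell_ge (R : realType) (q : R) (w : nat) : 1 <= q -> (0 < w)%N ->
  w%:R <= (2 * w%:R - 1 :> R) `^ q.
Proof.
move=> q1 w0; have w1 : (1 <= w%:R :> R) by rewrite ler1n.
by apply: le_trans (le1r_powR _ q1); lra.
Qed.

Lemma shifted_shell_bound (R : realType) (d : nat) (h : 'rV[R]_d -> R)
    (beta : R) (p : \bar R) (q M a : R) (x : 'rV[R]_d) (k : 'rV[int]_d) :
  0 < beta -> (1 <= p)%E -> 1 <= q -> 0 <= M ->
  (forall y, `|h y| <= M * expR (- (beta * lpnorm p y `^ q))) ->
  0 < a -> cube a x -> k != 0 ->
  `|h (x + (2 * a) *: map_mx intr k)| <=
    M * expR (- (beta * a `^ q * (2 * (supn k)%:R - 1) `^ q)).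
Proof.
move=> b0 p1 q1 M0 hM a0 xa k0; apply: (le_trans (hM _)).
have w1 : 1 <= (supn k)%:R :> R by rewrite ler1n lt0n supn_eq0.
have u0 : 0 <= 2 * (supn k)%:R - 1 :> R by lra.
rewrite ler_wpM2l// ler_expR lerN2 -mulrA -powRM ?(ltW a0)//.
have low := @lpnorm_shift_ge R d p a x k p1 (ltW a0) xa k0.
have au0 : 0 <= a * (2 * (supn k)%:R - 1) by rewrite mulr_ge0// ltW.
rewrite ler_wpM2l ?(ltW b0)//; apply: ge0_ler_powR; rewrite ?nnegrE//.
  by lra.
exact: le_trans low.
Qed.

(** * Error of the periodization *)

Theorem lemma4p7 (R : realType) (d : nat) (h : 'rV[R]_d -> R)
    (beta : R) (p : \bar R) (q : R)
    (beta_gt0 : 0 < beta) (p_ge1 : (1 <= p)%E) (q_ge1 : 1 <= q)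
    (h_decay : exp_decay0 beta p q h) :
  (Cdq d q < +oo)%E /\
  (forall (a : R) (x : 'rV[R]_d), 0 < a -> cube a x ->
     summable [set: 'rV[int]_d] (shifted a h x)) /\
  (forall (a : R) (x : 'rV[R]_d), beta `^ (- q^-1) <= a -> cube a x ->
     (`|h x - periodization a h x|%:E
        <= Cdq d q * expnorm0 beta p q h * (expR (- (beta * a `^ q)))%:E)%E).
Proof.
have [M [M0 ME hM]] := exp_decay0_bound _ _ _ _ _ _ h_decay.
have summ (a : R) (x : 'rV[R]_d) : 0 < a -> cube a x ->
    summable [set: 'rV[int]_d] (shifted a h x).
  move=> a0 xa; have c0 : 0 < beta * a `^ q by rewrite mulr_gt0// powR_gt0.
  rewrite /summable (esumID [set 0%R])// !setTI esum_set1//.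
  rewrite lte_add_pinfty ?ltry//.
  pose g (w : nat) := M * expR (- (beta * a `^ q * (2 * w%:R - 1) `^ q)).
  have g0 w : 0 <= g w by rewrite mulr_ge0// expR_ge0.
  apply: (@le_lt_trans _ _ (\esum_(k in ~` [set 0%R : 'rV[int]_d]) (g (supn k))%:E)%E).
    apply: le_esum => k /eqP k0; rewrite lee_fin.
    exact: (@shifted_shell_bound R d h beta p q M a x k).
  rewrite esum_shells//; apply: (shell_series_lty _ _ _ M _ c0) => w w0.
  rewrite g0/= ler_wpM2l// ler_expR lerN2 ler_wpM2l ?(ltW c0)//.
  exact: natr_shell_ge.
split; last split=> [//|a x ba xa].
  (* The constant e comes from the - 1 in the exponent of the series. *)
  apply: (shell_series_lty _ _ _ (expR 1) 1 ltr01) => w w0.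
  rewrite expR_ge0/= -expRD ler_expR mul1r.
  by have := natr_shell_ge R q w q_ge1 w0; lra.
have q0 : 0 < q by lra.
have a0 : 0 < a by apply: lt_le_trans ba; rewrite powR_gt0.
have ba1 : 1 <= beta * a `^ q.
  rewrite -ler_pdivrMl// mulr1.
  have -> : beta^-1 = (beta `^ (- q^-1)) `^ q.
    by rewrite -powRrM mulNr mulVf ?gt_eqF// powR_inv1// ltW.
  by apply: ge0_ler_powR; rewrite ?nnegrE ?powR_ge0 ?(ltW q0) ?(ltW a0).
have hx : h x = h (x + (2 * a) *: map_mx intr (0 : 'rV[int]_d)).
  by rewrite map_mx0 scaler0 addr0.
rewrite {1}hx; apply: le_trans (normr_esum_posneg_rem R _ 0 _ (summ a x a0 xa)) _.
pose T := beta * a `^ q.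
pose g (w : nat) := (M * expR (- T)) * expR (- ((2 * w%:R - 1) `^ q - 1)).
have g0 w : 0 <= g w by rewrite !mulr_ge0// expR_ge0.
apply: (@le_trans _ _ (\esum_(k in ~` [set 0%R : 'rV[int]_d]) (g (supn k))%:E)%E).
  apply: le_esum => k /eqP k0; rewrite lee_fin.
  apply: le_trans (shifted_shell_bound _ _ h beta p q M a x k _ _ _ _ _ _ _ _) _ => //.
  rewrite -/T /g -mulrA ler_wpM2l// -expRD ler_expR.
  have w0 : (0 < supn k)%N by rewrite lt0n supn_eq0.
  have w1 : 1 <= (supn k)%:R :> R by rewrite ler1n.
  have := natr_shell_ge R q _ q_ge1 w0.
  set u := _ `^ q => wu.
  (* Expanded, this is the inequality T u >= T + (u - 1). *)
  have : 0 <= (T - 1) * (u - 1) by rewrite mulr_ge0// subr_ge0//; lra.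
  lra.
have -> : (Cdq d q * expnorm0 beta p q h * (expR (- T))%:E =
           (M * expR (- T))%:E * Cdq d q)%E.
  by rewrite ME [(_ * Cdq d q)%E]muleC (EFinM M) muleA.
rewrite esum_shells// /Cdq [leLHS]eseries_cond.
rewrite [X in (_ * X)%E]eseries_cond -nneseriesZl => [|w /= w0].
  apply: lee_nneseries => [w _ /= w0|w /= w0].
    by rewrite lee_fin mulr_ge0// shell_card_ge0.
  by rewrite -EFinM lee_fin mulrCA.
by rewrite lee_fin mulr_ge0 ?expR_ge0// shell_card_ge0.
Qed.
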